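(* There exist absolute constants $c,c_1,c_2,c_3,c_4>0$ such that for every $M_0\in\mathbb{Z}^+$ there is an integer $M\ge 2$ with $c_1M_0\le M\le c_2M_0$ satisfying the following: for every (possibly randomized) allocator for Memory Reallocation with $M$ memory slots (where the total size of live objects may be as large as $M$), there is an update sequence, fixed in advance, in which all object sizes lie in $[c_3M/\log M,\ c_4M/\log M]$ and total live size never exceeds $M$, such that some update has expected switching cost at least $cM$.
   Context: Memory Reallocation: memory of $M$ slots indexed $0,\dots,M-1$; a dynamic set $X$ of live objects with sizes $\mu(x)\in\mathbb{Z}^+$; an allocation is $\phi\colon X\to\{0,\dots,M-1\}$ with $\phi(x)+\mu(x)\le M$ and pairwise disjoint intervals $[\phi(x),\phi(x)+\mu(x))$. Starting from $X=\varnothing$, updates (insert a new object of given size / delete a live object) arrive online; after each the allocator outputs an allocation of the new set $X'$, possibly moving existing objects. The (unnormalized) switching cost of an update inserting/deleting $x$ that changes $\phi$ to $\phi'$ is $\mu(x)+\sum_{y\in X\cap X',\ \phi(y)\ne\phi'(y)}\mu(y)$. Expectations are over the allocator's randomness (oblivious adversary). Logarithms base $2$. *)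

(* Defs.v *)
From HB Require Import structures.
From mathcomp Require Import all_boot all_order all_algebra finmap.
From mathcomp Require Import all_classical all_reals all_analysis.

Set Implicit Arguments.
Unset Strict Implicit.
Unset Printing Implicit Defensive.

Import Order.TTheory GRing.Theory Num.Theory.
Local Open Scope fset_scope.
Local Open Scope nat_scope.

(* An object is a pair (name, size), so that its size is revealed when it is
   inserted, and there are infinitely many objects of each size. *)
Notation object := (nat * nat)%type.
Definition mu (x : object) : nat := x.2.

Inductive update := Insert of object | Delete of object.

Definition updated (u : update) : object :=
  match u with Insert x => x | Delete x => x end.

Definition step (X : {fset object}) (u : update) : {fset object} :=
  match u with Insert x => x |` X | Delete x => X `\ x end.

Definition live (h : seq update) : {fset object} := foldl step fset0 h.

Definition inserted (h : seq update) : seq object :=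
  pmap (fun u => if u is Insert x then Some x else None) h.

Definition load (X : {fset object}) : nat := \sum_(x <- X) mu x.

(* Inserted objects are new: they are never reused after a deletion. *)
Inductive legal (M : nat) : seq update -> Prop :=
| legal_nil : legal M [::]
| legal_insert h x :
    legal M h -> x \notin inserted h -> 0 < mu x ->
    load (live (rcons h (Insert x))) <= M ->
    legal M (rcons h (Insert x))
| legal_delete h x :
    legal M h -> x \in live h -> legal M (rcons h (Delete x)).

(* phi is only meaningful on X; its values outside X are irrelevant. *)
Definition is_allocation (M : nat) (X : {fset object}) (phi : object -> nat) :
    Prop :=
  (forall x, x \in X -> phi x < M /\ phi x + mu x <= M) /\
  (forall x y, x \in X -> y \in X -> x != y ->
     phi x + mu x <= phi y \/ phi y + mu y <= phi x).

(* A randomized allocator, with random seed in T. Being online, the allocation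
   output after an update depends only on the seed and on the updates received
   so far. It must handle every legal history, up to total live size M. *)
Record allocator (M : nat) (d : measure_display) (T : measurableType d) := {
  alloc :> T -> seq update -> object -> nat;
  alloc_valid : forall w h, legal M h -> is_allocation M (live h) (alloc w h);
  alloc_measurable : forall h x, legal M h -> x \in live h ->
    measurable_fun [set: T] (fun w => alloc w h x)
}.

Definition switching_cost (X : {fset object}) (u : update)
    (phi phi' : object -> nat) : nat :=
  mu (updated u) +
  \sum_(y <- X `&` step X u | phi y != phi' y) mu y.

Definition expected_cost (R : realType) (M : nat) (d : measure_display)
    (T : measurableType d) (P : probability T R) (A : allocator M T)
    (h : seq update) (u : update) : \bar R :=
  ('E_P[fun w =>
     (switching_cost (live h) u (A w h) (A w (rcons h u)))%:R%R])%E.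

Definition log2 (R : realType) (x : R) : R := (ln x / ln 2)%R.

(* Main.v *)
Require Import Defs.
From HB Require Import structures.
From mathcomp Require Import all_boot all_order all_algebra finmap.
From mathcomp Require Import all_classical all_reals all_analysis.
From mathcomp Require Import measurable_realfun zify.

(** Take [n] objects of sizes [2^n + 2^i], [i < n], and let the memory be
    exactly full, so that every allocation is a tiling and the position of an
    object is the sum of the sizes to its left. All subset sums of these sizes
    are distinct. Now delete two objects [a] and [b] and insert one object of
    size [mu a + mu b]: the memory is full again. If another object [y] ends
    where it started, the sizes to its left have the same sum before and after,
    so distinctness of subset sums forces [a] and [b] to have been on the same
    side of [y]. Hence everything between [a] and [b] moves during the three
    updates. Among any three objects one lies between the other two, so over all
    pairs [(a, b)] an average of at least [(n + 1) / 3] objects is paid for,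
    whatever the random seed; averaging over the seed, the pair and the three
    updates gives one update of expected cost at least [2^n (n + 1) / 9]. *)

Set Implicit Arguments.
Unset Strict Implicit.
Unset Printing Implicit Defensive.

Import Order.TTheory GRing.Theory Num.Theory.
Local Open Scope ring_scope.

Lemma exists_ge_mean (R : realDomainType) (I : eqType) (s : seq I)
    (x : I -> \bar R) (b : R) :
  (0 < size s)%N -> ((b *+ size s)%:E <= \sum_(i <- s) x i)%E ->
  exists2 i, i \in s & (b%:E <= x i)%E.
Proof.
elim: s => // i s IH _; rewrite big_cons /= mulrS EFinD => b_le.
have [bxi|xib] := leP b%:E (x i); first by exists i; rewrite ?mem_head.
case: s IH b_le => [_|j s IH b_le].
  by rewrite big_nil !adde0 leNgt xib.
have [/(IH isT)[k ks bxk]|sum_lt] := leP (b *+ size (j :: s))%:E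
  (\sum_(k <- j :: s) x k)%E; first by exists k; rewrite // inE ks orbT.
by move: b_le; rewrite leNgt (lteD xib sum_lt).
Qed.

Section ExpectationMean.
Context (R : realType) (d : measure_display) (T : measurableType d).
Variable P : probability T R.

Lemma ge0_expectation_sum (I : Type) (s : seq I) (X : I -> T -> R) :
  (forall i, measurable_fun [set: T] (X i)) -> (forall i w, 0 <= X i w) ->
  ('E_P[fun w => (\sum_(i <- s) X i w)%R] = \sum_(i <- s) 'E_P[X i])%E.
Proof.
move=> mX X0; rewrite unlock -ge0_integral_sum //.
- by apply: eq_integral => w _; rewrite sumEFin.
- by move=> i; exact/measurable_EFinP.
- by move=> i w _; rewrite lee_fin.
Qed.

Lemma exists_expectation_ge_mean (I : eqType) (s : seq I) (X : I -> T -> R)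
    (b : R) :
  (0 < size s)%N -> 0 <= b ->
  {in s, forall i, measurable_fun [set: T] (X i)} ->
  {in s, forall i w, 0 <= X i w} ->
  (forall w, b *+ size s <= \sum_(i <- s) X i w) ->
  exists2 i, i \in s & (b%:E <= 'E_P[X i])%E.
Proof.
move=> s0 b0 mX X0 bX; pose Y i := if i \in s then X i else cst 0.
have XY : {in s, X =1 Y} by move=> i si; rewrite /Y si.
have mY i : measurable_fun [set: T] (Y i).
  by rewrite /Y; case: ifP => // si; exact: mX.
have Y0 i w : 0 <= Y i w by rewrite /Y; case: ifP => // si; exact: X0.
have sum_XY w : \sum_(i <- s) X i w = \sum_(i <- s) Y i w.
  by apply: eq_big_seq => i si; rewrite XY.
have [|i si bEi] := exists_ge_mean (x := fun i => 'E_P[Y i]%E) (b := b) s0;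
  last first.
  by exists i; rewrite // XY.
rewrite -ge0_expectation_sum // -(expectation_cst P).
apply: expectation_le => //.
- exact: measurable_sum.
- by move=> w; rewrite mulrn_wge0.
- by move=> w; exact: sumr_ge0.
- by apply/aeW => w; rewrite -sum_XY.
Qed.
End ExpectationMean.

Lemma measurable_natr (R : realType) (d : measure_display)
    (T : measurableType d) (f : T -> nat) :
  measurable_fun [set: T] f -> measurable_fun [set: T] (fun w => (f w)%:R : R).
Proof.
by move=> mf; apply: (measurableT_comp (f := fun n : nat => n%:R : R)).
Qed.

Local Open Scope fset_scope.
Local Open Scope nat_scope.

Lemma measurable_fun_sumn (d : measure_display) (T : measurableType d)
    (I : eqType) (s : seq I) (f : I -> T -> nat) :
  {in s, forall i, measurable_fun [set: T] (f i)} ->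
  measurable_fun [set: T] (fun w => \sum_(i <- s) f i w).
Proof.
elim: s => [_|i s IH mf].
  by under eq_fun do rewrite big_nil; exact: measurable_cst.
under eq_fun do rewrite big_cons.
apply: measurable_fun_addn; first by apply: mf; rewrite mem_head.
by apply: IH => j js; apply: mf; rewrite inE js orbT.
Qed.

(** * Histories and their costs *)

Lemma live_cat (h us : seq update) : live (h ++ us) = foldl step (live h) us.
Proof. exact: foldl_cat. Qed.

Lemma inserted_cat (h us : seq update) :
  inserted (h ++ us) = inserted h ++ inserted us.
Proof. exact: pmap_cat. Qed.

Lemma legal_rcons (M : nat) (h : seq update) (u : update) :
  legal M (rcons h u) -> legal M h.
Proof.
move E : (rcons h u) => g lg; case: lg E => [|h' x lh _ _ _|h' x lh _].
- by case: h.
- by move/rcons_inj => [->].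
- by move/rcons_inj => [->].
Qed.

Lemma legal_catl (M : nat) (h r : seq update) : legal M (h ++ r) -> legal M h.
Proof.
elim/last_ind: r => [|r u IH]; first by rewrite cats0.
by rewrite -rcons_cat => /legal_rcons.
Qed.

Definition update_cost (A : seq update -> object -> nat) (h : seq update)
    (u : update) : nat :=
  switching_cost (live h) u (A h) (A (rcons h u)).

Lemma measurable_update_cost (M : nat) (d : measure_display)
    (T : measurableType d) (A : allocator M T) (h : seq update) (u : update) :
  legal M (rcons h u) ->
  measurable_fun [set: T] (fun w => update_cost (A w) h u).
Proof.
move=> lhu; have lh := legal_rcons lhu.
apply: measurable_fun_addn; first exact: measurable_cst.
under eq_fun do rewrite big_mkcond.
apply: measurable_fun_sumn => y /fsetIP[y_before y_after].
apply: measurable_fun_ifT => //.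
apply: measurable_neg; apply: measurable_fun_eqn; apply: alloc_measurable => //.
by rewrite /live foldl_rcons.
Qed.

Lemma inserted_map_Insert (s : seq object) :
  inserted [seq Insert x | x <- s] = s.
Proof. by elim: s => //= x s; rewrite /inserted /= => ->. Qed.

Lemma live_map_Insert (s : seq object) : live [seq Insert x | x <- s] =i s.
Proof.
elim/last_ind: s => [|s x IH] y; first by rewrite inE.
by rewrite map_rcons -cats1 live_cat /= in_fset1U IH mem_rcons.
Qed.

Lemma legal_map_Insert (M : nat) (s : seq object) :
  uniq s -> {in s, forall x, 0 < mu x} -> \sum_(x <- s) mu x <= M ->
  legal M [seq Insert x | x <- s].
Proof.
elim/last_ind: s => [|s x IH]; first by constructor.
move=> uxs s0 sM; move: (uxs); rewrite rcons_uniq => /andP[xs us].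
rewrite map_rcons; constructor.
- apply: IH => // [y ys|]; first by apply: s0; rewrite mem_rcons inE ys orbT.
  by apply: leq_trans sM; rewrite big_rcons /=; exact: leq_addr.
- by rewrite inserted_map_Insert.
- by apply: s0; rewrite mem_rcons mem_head.
- rewrite -map_rcons /load (perm_big (rcons s x)) //; apply: uniq_perm => //.
    exact: fset_uniq.
  exact: live_map_Insert.
Qed.

Definition fill (X : {fset object}) : seq update := [seq Insert x | x <- X].

Lemma live_fill (X : {fset object}) : live (fill X) = X.
Proof. by apply/fsetP => x; rewrite live_map_Insert. Qed.

Lemma legal_fill (X : {fset object}) :
  {in X, forall x, 0 < mu x} -> legal (load X) (fill X).
Proof. by move=> mu0; apply: legal_map_Insert; rewrite ?fset_uniq. Qed.

HB.instance Definition _ := gen_eqMixin update.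

Fixpoint timeline (h us : seq update) : seq (seq update * update) :=
  if us is u :: us' then (h, u) :: timeline (rcons h u) us' else [::].

Lemma mem_timeline (h us g : seq update) (u : update) :
  (g, u) \in timeline h us -> exists r, h ++ us = g ++ u :: r.
Proof.
elim: us h => //= v us IH h; rewrite inE => /orP[/eqP[-> ->]|/IH[r gur]].
  by exists us.
by exists r; rewrite -gur cat_rcons.
Qed.

Definition total_cost (A : seq update -> object -> nat) (h us : seq update) :
    nat :=
  \sum_(p <- timeline h us) update_cost A p.1 p.2.

Lemma total_cost_cons (A : seq update -> object -> nat) (h us : seq update)
    (u : update) :
  total_cost A h (u :: us) = update_cost A h u + total_cost A (rcons h u) us.
Proof. by rewrite /total_cost big_cons. Qed.

Lemma sum_neq_triangle (I : Type) (T : eqType) (s : seq I) (f g h : I -> T)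
    (m : I -> nat) :
  \sum_(i <- s | f i != h i) m i <=
  \sum_(i <- s | f i != g i) m i + \sum_(i <- s | g i != h i) m i.
Proof.
rewrite !(big_mkcond (fun i => _ i != _ i)) -big_split /=.
apply: leq_sum => i _.
have [->|_] := eqVneq (f i) (g i); first by rewrite add0n.
by case: ifP => // _; exact: leq_addr.
Qed.

Lemma total_cost_geq (A : seq update -> object -> nat) (h us : seq update)
    (Y : {fset object}) :
  Y `<=` live h -> {in us, forall u, Y `<=` step Y u} ->
  \sum_(y <- Y | A h y != A (h ++ us) y) mu y + \sum_(u <- us) mu (updated u) <=
  total_cost A h us.
Proof.
elim: us h => [|u us IH] h Yh Yus.
  by rewrite cats0 !big_nil big_pred0 // => y; rewrite eqxx.
have step_mono (X Z : {fset object}) : X `<=` Z -> step X u `<=` step Z u.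
  by case: u {Yus} => x XZ /=; [exact: fsetUS|exact: fsetSD].
have Yhu : Y `<=` step (live h) u.
  by apply: fsubset_trans (step_mono _ _ Yh); apply: Yus; rewrite mem_head.
rewrite -cat_rcons total_cost_cons big_cons /update_cost /switching_cost.
have Ycost : \sum_(y <- Y | A h y != A (rcons h u) y) mu y <=
    \sum_(y <- live h `&` step (live h) u | A h y != A (rcons h u) y) mu y.
  apply: uniq_sub_le_big => [//|x y|||x Yx]; rewrite ?fset_uniq ?leq_addr //.
  by rewrite in_fsetI (fsubsetP Yh) ?(fsubsetP Yhu).
have IHhu : \sum_(y <- Y | A (rcons h u) y != A (rcons h u ++ us) y) mu y +
    \sum_(v <- us) mu (updated v) <= total_cost A (rcons h u) us.
  apply: IH => [|v vus]; first by rewrite -cats1 live_cat.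
  by apply: Yus; rewrite inE vus orbT.
rewrite addnCA -addnA leq_add2l; apply: leq_trans (leq_add Ycost IHhu).
by rewrite addnA leq_add2r; exact: sum_neq_triangle.
Qed.

(** * Tilings *)

Lemma sum_disjoint_intervals_leq (I : eqType) (s : seq I) (l m : I -> nat)
    (a b : nat) :
  uniq s -> {in s, forall i, a <= l i /\ l i + m i <= b} ->
  {in s &, forall i j, i != j -> l i + m i <= l j \/ l j + m j <= l i} ->
  \sum_(i <- s) m i <= b - a.
Proof.
move=> us sab dis; pose t := flatten [seq iota (l i) (m i) | i <- s].
have <- : size t = \sum_(i <- s) m i.
  rewrite size_flatten /shape -map_comp sumnE big_map.
  by apply: eq_bigr => i _ /=; rewrite size_iota.
rewrite -[leqRHS](size_iota a); apply: uniq_leq_size; last first.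
  move=> k /flatten_mapP[i si]; rewrite !mem_iota => /andP[].
  by have [] := sab i si; lia.
rewrite {}/t; elim: s us {sab} dis => //= i s IH /andP[si us] dis.
rewrite cat_uniq iota_uniq IH //=; last first.
  by move=> j k js ks; apply: dis; rewrite inE ?js ?ks orbT.
rewrite andbT; apply/hasPn => k /flatten_mapP[j js].
rewrite /= !mem_iota; have ij : i != j by apply: contraNneq si => ->.
by have := dis i j (mem_head _ _) _ ij; rewrite inE js orbT => /(_ isT); lia.
Qed.

Lemma is_allocation_inj (M : nat) (X : {fset object}) (phi : object -> nat) :
  {in X, forall x, 0 < mu x} -> is_allocation M X phi ->
  {in X &, injective phi}.
Proof.
move=> mu_gt0 [_ disj] x y xX yX phixy; apply: contraTeq isT => xy.
have := mu_gt0 x xX; have := mu_gt0 y yX.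
by have := disj x y xX yX xy; rewrite phixy; lia.
Qed.

Lemma tiling_position (M : nat) (X : {fset object}) (phi : object -> nat)
    (y : object) :
  is_allocation M X phi -> load X = M -> y \in X ->
  phi y = load [fset x in X | phi x < phi y].
Proof.
move=> [in_range disj] full yX.
have left_le : load [fset x in X | phi x < phi y] <= phi y - 0.
  apply: (@sum_disjoint_intervals_leq _ _ phi) => [|x|x z].
  - exact: fset_uniq.
  - rewrite !inE => /andP[xX lt_xy]; split => //.
    have xy : x != y by apply: contraTneq lt_xy => ->; rewrite ltnn.
    by case: (disj x y xX yX xy); lia.
  - by rewrite !inE => /andP[xX _] /andP[zX _]; exact: disj.
have right_le : load [fset x in X | ~~ (phi x < phi y)] <= M - phi y.
  apply: (@sum_disjoint_intervals_leq _ _ phi) => [|x|x z].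
  - exact: fset_uniq.
  - by rewrite !inE -leqNgt => /andP[xX le_yx]; have [] := in_range x xX.
  - by rewrite !inE => /andP[xX _] /andP[zX _]; exact: disj.
have := (in_range y yX).1; move: left_le right_le full.
rewrite /load -!big_fset_condE.
by rewrite [X in X = M](bigID (fun x => phi x < phi y)) /=; lia.
Qed.

(** * Betweenness *)

Definition between (disp : Order.disp_t) (T : orderType disp) (x y z : T) :
    bool :=
  (x <= z <= y)%O || (y <= z <= x)%O.

Lemma between_cyclic (disp : Order.disp_t) (T : orderType disp) (x y z : T) :
  1 + (x == y) <= between x y z + between y z x + between z x y.
Proof.
have le_trans_xyz : (x <= y <= z)%O ==> (x <= z)%O.
  by apply/implyP => /andP[]; exact: le_trans.
have le_trans_zyx : (z <= y <= x)%O ==> (z <= x)%O.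
  by apply/implyP => /andP[]; exact: le_trans.
move: (le_total x y) (le_total y z) (le_total x z) le_trans_xyz le_trans_zyx.
rewrite /between !eq_le.
by do 6![case: (_ <= _)%O => //].
Qed.

Section SumBetween.
Context (disp : Order.disp_t) (T : orderType disp) (I : finType).
Variable f : I -> T.
Hypothesis f_inj : injective f.

Let bet i j k : nat := between (f i) (f j) (f k).

Lemma sum_between_triples_geq :
  #|I| * (#|I| * #|I|.+1) <= 3 * \sum_i \sum_j \sum_k bet i j k.
Proof.
set triples := \sum_i \sum_j \sum_k bet i j k.
have sum_jki : triples = \sum_i \sum_j \sum_k bet j k i.
  by rewrite [RHS]exchange_big; apply: eq_bigr => j _; rewrite exchange_big.
have sum_kij : triples = \sum_i \sum_j \sum_k bet k i j.
  rewrite /triples exchange_big.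
  by apply: eq_bigr => i _; rewrite exchange_big.
have -> : 3 * triples =
    \sum_i \sum_j \sum_k (bet i j k + bet j k i + bet k i j).
  rewrite 2!mulSn mul1n {2}sum_jki {2}sum_kij addnA -!big_split.
  apply: eq_bigr => i _; rewrite -!big_split.
  by apply: eq_bigr => j _; rewrite -!big_split.
have row_sum i : \sum_(j : I) (1 + (i == j)) = #|I|.+1.
  rewrite big_split sum1_card (bigD1 i) //= eqxx big1 ?addn1 // => j.
  by rewrite eq_sym => /negbTE ->.
have -> : #|I| * (#|I| * #|I|.+1) =
    \sum_(i : I) \sum_(j : I) \sum_(k : I) (1 + (i == j)).
  rewrite -[LHS]sum_nat_const; apply: eq_bigr => i _.
  rewrite -(row_sum i) big_distrr; apply: eq_bigr => j _.
  by rewrite sum_nat_const.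
apply: leq_sum => i _; apply: leq_sum => j _; apply: leq_sum => k _.
by rewrite -(inj_eq f_inj); exact: between_cyclic.
Qed.

Lemma sum_between_diag (i : I) : \sum_k bet i i k = 1.
Proof.
rewrite (bigD1 i) //= /bet /between lexx big1 ?addn0 // => k ki.
by rewrite orbb -eq_le (inj_eq f_inj) eq_sym (negbTE ki).
Qed.

Lemma sum_between_geq :
  #|I| * #|I|.-1 * #|I|.+1 <=
  3 * \sum_i \sum_(j | j != i) \sum_k between (f i) (f j) (f k).
Proof.
have split_diag : \sum_i \sum_j \sum_k bet i j k =
    \sum_i \sum_(j | j != i) \sum_k bet i j k + #|I|.
  rewrite -sum1_card -big_split; apply: eq_bigr => i _.
  by rewrite (bigD1 i) //= sum_between_diag addnC.
have := sum_between_triples_geq; rewrite split_diag /bet.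
by move: (\sum_i \sum_(j | _) _); case: #|I| => [|n] offdiag /=; nia.
Qed.
End SumBetween.

(** * Exchanging two objects for one *)

Definition distinct_subset_sums (X : {fset object}) : Prop :=
  {in fpowerset X &, injective load}.

Lemma distinct_subset_sums_mu_gt0 (X : {fset object}) :
  distinct_subset_sums X -> {in X, forall x, 0 < mu x}.
Proof.
move=> dX x xX; rewrite lt0n; apply: contraTneq isT => mu0.
have /eqP : [fset x] = fset0.
  apply: dX; rewrite ?fpowersetE ?fsub0set ?fsub1set //.
  by rewrite /load big_seq_fset1 big_seq_fset0.
by rewrite -cardfs_eq0 cardfs1.
Qed.

(* The name [0] is harmless: when subset sums are distinct, no object has the
   size of two others together, so the merged object is new. *)
Definition merge (a b : object) : object := (0, mu a + mu b).

Definition exchange (a b : object) : seq update :=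
  [:: Delete a; Delete b; Insert (merge a b)].

Lemma inserted_exchange (X : {fset object}) (a b : object) :
  inserted (fill X ++ exchange a b) = rcons X (merge a b).
Proof. by rewrite inserted_cat inserted_map_Insert /= cats1. Qed.

Lemma mu_inserted_exchange (X : {fset object}) (a b : object) (lo hi : nat) :
  a \in X -> b \in X -> {in X, forall x, lo <= mu x <= hi} ->
  {in inserted (fill X ++ exchange a b), forall x, lo <= mu x <= 2 * hi}.
Proof.
move=> aX bX mu_bounds x; rewrite inserted_exchange mem_rcons inE.
have := mu_bounds a aX; have := mu_bounds b bX.
by move=> ? ? /orP[/eqP->|/mu_bounds]; rewrite /mu /=; lia.
Qed.

Section Exchange.
Variables (X : {fset object}) (a b : object).
Hypothesis dX : distinct_subset_sums X.
Hypotheses (aX : a \in X) (bX : b \in X) (ab : a != b).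

Definition exchanged : {fset object} := merge a b |` (X `\ a `\ b).

Lemma merge_notin : merge a b \notin X.
Proof.
apply/negP => mX; have : [fset a; b] = [fset merge a b].
  apply: dX; rewrite ?fpowersetE ?fsubUset ?fsub1set ?aX ?bX //.
  by rewrite /load big_fsetU1 ?inE //= !big_seq_fset1.
by move/(congr1 (fun Z : {fset object} => #|` Z|)); rewrite cardfs1 cardfs2 ab.
Qed.

Lemma load_exchanged : load exchanged = load X.
Proof.
rewrite /load big_fsetU1 /=; last by rewrite !inE (negbTE merge_notin) !andbF.
rewrite [RHS](big_fsetD1 a aX) /= [in RHS](big_fsetD1 b) /= ?addnA //.
by rewrite !inE eq_sym ab.
Qed.

Lemma live_exchange : live (fill X ++ exchange a b) = exchanged.
Proof. by rewrite live_cat live_fill. Qed.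

Lemma legal_exchange : legal (load X) (fill X ++ exchange a b).
Proof.
have mu_gt0 := distinct_subset_sums_mu_gt0 dX.
rewrite /exchange -!cat_rcons cats0; apply: legal_insert.
- apply: legal_delete.
    by apply: legal_delete; [exact: legal_fill|rewrite live_fill].
  by rewrite -cats1 live_cat live_fill /= !inE eq_sym ab bX.
- by rewrite -!cats1 !inserted_cat inserted_map_Insert /= !cats0 merge_notin.
- by rewrite addn_gt0 mu_gt0.
- by rewrite -!cats1 -!catA live_exchange load_exchanged.
Qed.

Lemma notin_exchanged (x : object) : x \in [fset a; b] -> x \notin exchanged.
Proof.
rewrite !inE => /orP[]/eqP->; rewrite eqxx ?andbF orbF.
- by apply: contraTneq aX => ->; exact: merge_notin.
- by apply: contraTneq bX => ->; exact: merge_notin.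
Qed.

Definition unmerge (Z : {fset object}) : {fset object} :=
  if merge a b \in Z then a |` (b |` (Z `\ merge a b)) else Z.

Lemma unmerge_sub (Z : {fset object}) : Z `<=` exchanged -> unmerge Z `<=` X.
Proof.
move=> ZX'; have ZX x : x \in Z -> x != merge a b -> x \in X.
  move=> /(fsubsetP ZX'); rewrite !inE => /orP[->//|/and3P[_ _ xX] _].
  exact: xX.
apply/fsubsetP => x; rewrite /unmerge; case: ifPn => [_|mZ xZ].
  by rewrite !inE => /or3P[/eqP->|/eqP->|/andP[xm xZ]] //; exact: ZX.
by apply: ZX => //; apply: contraNneq mZ => <-.
Qed.

Lemma load_unmerge (Z : {fset object}) :
  Z `<=` exchanged -> load (unmerge Z) = load Z.
Proof.
move=> ZX'; rewrite /unmerge; case: ifPn => // mZ.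
have notinZ x : x \in [fset a; b] -> x \notin Z `\ merge a b.
  move=> /notin_exchanged; apply: contra.
  by rewrite in_fsetD1 => /andP[_]; exact: (fsubsetP ZX').
rewrite /load big_fsetU1 /=; last first.
  by rewrite in_fsetU in_fset1 negb_or ab notinZ ?fset21.
by rewrite big_fsetU1 ?notinZ ?fset22 // [RHS](big_fsetD1 _ mZ) /= addnA.
Qed.

Lemma mem_unmerge (Z : {fset object}) (x : object) :
  Z `<=` exchanged -> x \in [fset a; b] ->
  (x \in unmerge Z) = (merge a b \in Z).
Proof.
move=> ZX' xab; rewrite /unmerge; case: ifPn => _.
  by move: xab; rewrite !inE => /orP[]->; rewrite ?orbT.
by apply: contraNF (notin_exchanged xab); exact: (fsubsetP ZX').
Qed.

Lemma unmoved_same_side (phi phi' : object -> nat) (y : object) :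
  is_allocation (load X) X phi -> is_allocation (load X) exchanged phi' ->
  y \in X `\ a `\ b -> phi y = phi' y -> (phi a < phi y) = (phi b < phi y).
Proof.
move=> alloc alloc' yXab stay.
have yX : y \in X by move: yXab; rewrite !inE => /and3P[].
have yX' : y \in exchanged by rewrite in_fset1U yXab orbT.
pose left := [fset x in X | phi x < phi y].
pose left' := [fset x in exchanged | phi' x < phi' y].
have left'_sub : left' `<=` exchanged by exact: fset_sub.
have left_eq : left = unmerge left'.
  apply: dX; rewrite ?fpowersetE ?unmerge_sub ?fset_sub // load_unmerge //.
  rewrite -(tiling_position alloc _ yX) // stay.
  by rewrite (tiling_position alloc' load_exchanged yX').
have mem_left x : x \in X -> (phi x < phi y) = (x \in left).
  by move=> xX; rewrite !inE xX.
by rewrite !mem_left // left_eq !mem_unmerge ?fset21 ?fset22.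
Qed.

Lemma between_moved (phi phi' : object -> nat) (y : object) :
  is_allocation (load X) X phi -> is_allocation (load X) exchanged phi' ->
  y \in X `\ a `\ b -> between (phi a) (phi b) (phi y) -> phi y != phi' y.
Proof.
move=> alloc alloc' yXab y_between; apply/eqP => stay.
have := unmoved_same_side alloc alloc' yXab stay.
move: yXab; rewrite !inE => /and3P[yb ya yX].
have phi_inj := is_allocation_inj (distinct_subset_sums_mu_gt0 dX) alloc.
have phi_ya : phi y != phi a by apply: contra_neq ya; exact: phi_inj.
have phi_yb : phi y != phi b by apply: contra_neq yb; exact: phi_inj.
by move: y_between; rewrite /between !leEnat; lia.
Qed.

Lemma exchange_cost_geq (A : seq update -> object -> nat) (s : nat) :
  {in X, forall x, s <= mu x} ->
  is_allocation (load X) X (A (fill X)) ->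
  is_allocation (load X) exchanged (A (fill X ++ exchange a b)) ->
  s * \sum_(y <- X) between (A (fill X) a) (A (fill X) b) (A (fill X) y) <=
  total_cost A (fill X) (exchange a b).
Proof.
move=> smu alloc alloc'; set phi := A (fill X); set Y := X `\ a `\ b.
have YX : Y `<=` X by rewrite (fsubset_trans (fsubD1set _ _)) ?fsubD1set.
have Ycost : \sum_(y <- Y) s * between (phi a) (phi b) (phi y) <=
    \sum_(y <- Y | phi y != A (fill X ++ exchange a b) y) mu y.
  rewrite [leqRHS]big_mkcond big_seq [leqRHS]big_seq; apply: leq_sum => y yY.
  case: (boolP (between _ _ _)) => [y_between|_]; last by rewrite muln0.
  by rewrite (between_moved alloc alloc') // muln1 smu // (fsubsetP YX).
have Ysurvives : {in exchange a b, forall u, Y `<=` step Y u}.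
  move=> u; rewrite !inE => /or3P[] /eqP -> /=.
  - by rewrite mem_fsetD1 // !inE eqxx /= andbF.
  - by rewrite mem_fsetD1 // !inE eqxx.
  - exact: fsubsetUr.
apply: leq_trans _ (total_cost_geq A _ Ysurvives); last by rewrite live_fill.
rewrite big_distrr /= (big_fsetD1 a aX) (big_fsetD1 b) ?inE 1?eq_sym ?ab //=.
rewrite !big_cons /= -/Y.
have pays x (moved : bool) : x \in X -> s * moved <= mu x.
  by move=> xX; case: moved; rewrite ?muln0 // muln1 smu.
apply: leq_trans (leq_add (pays _ _ aX) (leq_add (pays _ _ bX) Ycost)) _.
by rewrite addnA addnC leq_add2l addnA leq_addr.
Qed.
End Exchange.

(** * Averaging over the exchanged pair *)

Section AverageExchange.
Variable X : {fset object}.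
Hypothesis dX : distinct_subset_sums X.

Definition distinct_pairs : {pred X * X} := [pred e | e.2 != e.1].

Definition exchange_timelines : seq (seq update * update) :=
  [seq p | e <- enum distinct_pairs,
           p <- timeline (fill X) (exchange (val e.1) (val e.2))].

Lemma card_distinct_pairs : #|distinct_pairs| = #|` X| * #|` X|.-1.
Proof.
rewrite -sum1_card -(pair_big_dep xpredT (fun x y => y != x) (fun _ _ => 1)) /=.
by under eq_bigr do rewrite sum1_card cardC1; rewrite sum_nat_const cardfE.
Qed.

Lemma size_exchange_timelines : size exchange_timelines = 3 * #|distinct_pairs|.
Proof.
rewrite size_allpairs_dep cardE mulnC.
by elim: (enum _) => //= e es ->; rewrite mulSn.
Qed.

Lemma mem_exchange_timelines (h : seq update) (u : update) :
  (h, u) \in exchange_timelines ->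
  exists a b, [/\ a \in X, b \in X, a != b &
    exists r, fill X ++ exchange a b = h ++ u :: r].
Proof.
move=> /allpairsPdep[[x y] [p [+ + hu]]].
rewrite -{p}hu mem_enum => yx /mem_timeline exchange_eq.
exists (val x), (val y); split; first exact: fsvalP.
- exact: fsvalP.
- by rewrite (inj_eq val_inj) eq_sym.
- exact: exchange_eq.
Qed.

Lemma sum_exchange_timelines_geq d (T : measurableType d)
    (A : allocator (load X) T) (w : T) (s : nat) :
  {in X, forall x, s <= mu x} ->
  s * (#|distinct_pairs| * #|` X|.+1) <=
  3 * \sum_(p <- exchange_timelines) update_cost (A w) p.1 p.2.
Proof.
move=> s_leq_mu; rewrite big_allpairs_dep big_enum /=; set phi := A w (fill X).
have mu_gt0 := distinct_subset_sums_mu_gt0 dX.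
have alloc : is_allocation (load X) X phi.
  by rewrite -{2}(live_fill X); apply: alloc_valid; exact: legal_fill.
have phi_inj : injective (fun x : X => phi (val x)).
  by move=> x y /(is_allocation_inj mu_gt0 alloc (valP x) (valP y)) /val_inj.
have := leq_mul (leqnn s) (sum_between_geq phi_inj).
rewrite -cardfE -card_distinct_pairs => /leq_trans; apply.
rewrite mulnCA leq_mul2l /= pair_big_dep big_distrr /=.
apply: leq_sum => -[x y] /= yx.
have xy : val x != val y by rewrite (inj_eq val_inj) eq_sym.
have legal_xy := legal_exchange dX (valP x) (valP y) xy.
have := alloc_valid A w legal_xy; rewrite live_exchange => alloc'.
by have := exchange_cost_geq dX (valP x) (valP y) xy s_leq_mu alloc alloc';
  rewrite big_seq_fsetE.
Qed.

Lemma exists_costly_exchange (R : realType) d (T : measurableType d)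
    (P : probability T R) (A : allocator (load X) T) (s : nat) :
  {in X, forall x, s <= mu x} -> 1 < #|` X| ->
  exists a b, [/\ a \in X, b \in X, a != b &
    exists h u r, fill X ++ exchange a b = h ++ u :: r /\
      (((s * #|` X|.+1)%:R / 9%:R)%R%:E <= expected_cost P A h u)%E].
Proof.
move=> s_leq_mu X_gt1.
pose cost (p : seq update * update) w : R :=
  (update_cost (A w) p.1 p.2)%:R%R.
have [||||w|[h u] hu cost_geq] := @exists_expectation_ge_mean R d T P _
  exchange_timelines cost ((s * #|` X|.+1)%:R / 9%:R)%R.
- by rewrite size_exchange_timelines card_distinct_pairs; lia.
- by rewrite divr_ge0.
- move=> [h u] /mem_exchange_timelines[a [b [aX bX ab [r exchange_eq]]]].
  apply/measurable_natr/measurable_update_cost.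
  apply: (@legal_catl _ _ r); rewrite cat_rcons -exchange_eq.
  exact: legal_exchange.
- by [].
- rewrite -natr_sum -[leLHS]mulr_natr mulrAC ler_pdivrMr // -!natrM ler_nat.
  rewrite size_exchange_timelines mulnCA [leqRHS]mulnC -[9]/(3 * 3).
  rewrite -[leqRHS]mulnA leq_mul2l /= -mulnA [_.+1 * _]mulnC.
  exact: sum_exchange_timelines_geq.
- have [a [b [aX bX ab [r exchange_eq]]]] := mem_exchange_timelines hu.
  by exists a, b; split => //; exists h, u, r.
Qed.
End AverageExchange.

(** * Sizes near a power of two *)

Lemma superincreasing_subset_sum_inj (a : nat -> nat) :
  (forall i, \sum_(j < i) a j < a i) -> forall (n : nat) (P Q : pred nat),
  \sum_(i < n | P i) a i = \sum_(i < n | Q i) a i ->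
  forall i, i < n -> P i = Q i.
Proof.
move=> a_gt n P Q; elim: n => // n IH.
have sum_lt (B : pred nat) : \sum_(i < n | B i) a i < a n.
  apply: leq_ltn_trans (a_gt n); apply: sub_le_big => // x y.
  exact: leq_addr.
rewrite [LHS]big_mkcond [RHS]big_mkcond !big_ord_recr -!big_mkcond /= => eqPQ.
have PQn : P n = Q n.
  move: eqPQ (sum_lt P) (sum_lt Q).
  move: (\sum_(i < n | P i) _) (\sum_(i < n | Q i) _) => p q.
  by case: (P n); case: (Q n) => //; lia.
move=> i; rewrite ltnS leq_eqVlt => /orP[/eqP -> //|]; apply: IH.
by move: eqPQ; rewrite PQn => /addIn.
Qed.

Lemma shifted_subset_sum_inj (c n : nat) (a : nat -> nat) (P Q : pred nat) :
  (forall i, \sum_(j < i) a j < a i) -> \sum_(i < n) a i < c ->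
  \sum_(i < n | P i) (c + a i) = \sum_(i < n | Q i) (c + a i) ->
  forall i, i < n -> P i = Q i.
Proof.
move=> a_gt sum_lt eqPQ; apply: (superincreasing_subset_sum_inj a_gt).
have lt_c (B : pred nat) : \sum_(i < n | B i) a i < c.
  by apply: leq_ltn_trans sum_lt; apply: sub_le_big => // x y; exact: leq_addr.
move: eqPQ; rewrite !big_split /= !sum_nat_const => /(congr1 (modn^~ c)).
by rewrite !modnMDl !modn_small.
Qed.

Definition pow2_object (n i : nat) : object := (i, 2 ^ n + 2 ^ i).

Definition pow2_objects (n : nat) : {fset object} :=
  [fset pow2_object n (val i) | i in 'I_n].

Section PowersOfTwo.
Variable n : nat.

Lemma pow2_object_inj : injective (fun i : 'I_n => pow2_object n i).
Proof. by move=> i j [] /val_inj. Qed.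

Lemma card_pow2_objects : #|` pow2_objects n| = n.
Proof.
by rewrite (card_imfset _ _ pow2_object_inj) -cardE card_ord.
Qed.

Lemma load_sub_pow2_objects (Y : {fset object}) : Y `<=` pow2_objects n ->
  load Y = \sum_(i < n | pow2_object n i \in Y) (2 ^ n + 2 ^ i).
Proof.
move=> YX; have YE : Y = [fset x in pow2_objects n | x \in Y].
  apply/fsetP => x; rewrite !inE /=.
  by case: (boolP (x \in Y)) => [/(fsubsetP YX) ->|_]; rewrite ?andbF.
rewrite [in LHS]YE /load -big_fset_condE big_mkcond big_imfset /=; last first.
  by move=> i j _ _; exact: pow2_object_inj.
by rewrite -big_mkcond big_enum_cond.
Qed.

Lemma sum_pow2 (m : nat) : (\sum_(i < m) 2 ^ i).+1 = 2 ^ m.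
Proof.
by have := predn_exp 2 m; rewrite mul1n => <-; rewrite prednK ?expn_gt0.
Qed.

Lemma distinct_subset_sums_pow2 : distinct_subset_sums (pow2_objects n).
Proof.
move=> Y Z; rewrite !fpowersetE => YX ZX.
have pow2_gt i : \sum_(j < i) 2 ^ j < 2 ^ i by rewrite -sum_pow2.
rewrite !load_sub_pow2_objects // => load_eq; apply/fsetP => x.
have [/imfsetP[i _ ->]|xX] := boolP (x \in pow2_objects n).
  exact: (@shifted_subset_sum_inj _ n _ (fun k => pow2_object n k \in Y)
    (fun k => pow2_object n k \in Z) pow2_gt (pow2_gt n) load_eq i (ltn_ord i)).
by rewrite !(contraNF (fsubsetP _ x) xX).
Qed.

Lemma load_pow2_objects : (load (pow2_objects n)).+1 = n.+1 * 2 ^ n.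
Proof.
rewrite load_sub_pow2_objects // (eq_bigl xpredT); last first.
  by move=> i; apply/imfsetP; exists i.
by rewrite big_split /= sum_nat_const card_ord -addnS sum_pow2 mulSn addnC.
Qed.

Lemma mu_pow2_objects :
  {in pow2_objects n, forall x, 2 ^ n <= mu x <= 2 * 2 ^ n}.
Proof.
move=> _ /imfsetP[i _ ->]; rewrite /mu /= leq_addr mul2n -addnn leq_add2l.
by rewrite leq_exp2l // (ltnW (ltn_ord i)).
Qed.
End PowersOfTwo.

Lemma exists_load_pow2_objects (m : nat) : 0 < m ->
  exists n, [/\ 1 < n, m <= load (pow2_objects n) &
    load (pow2_objects n) <= 11 * m].
Proof.
elim: m => // -[_ _|m /(_ isT)[n [n1 m_le le_m]] _].
  by exists 2; have := load_pow2_objects 2; rewrite -[3 * 2 ^ 2]/12; split; lia.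
have [m_lt|load_le] := ltnP m.+1 (load (pow2_objects n)).
  by exists n; split => //; lia.
exists n.+1; have := load_pow2_objects n; have := load_pow2_objects n.+1.
rewrite expnS; have : 0 < 2 ^ n by rewrite expn_gt0.
by split; nia.
Qed.

Local Close Scope nat_scope.
Local Close Scope fset_scope.

Lemma log2_exp2 (R : realType) (k : nat) : log2 (2 ^ k)%N%:R = k%:R :> R.
Proof.
have ln2_gt0 : 0 < ln 2 :> R by rewrite ln_gt0 // ltr1n.
by rewrite /log2 natrX lnXn // -[_ *+ k]mulr_natl mulfK ?gt_eqF.
Qed.

Lemma ler_log2 (R : realType) : {in Num.pos &, {mono @log2 R : x y / x <= y}}.
Proof.
move=> x y x0 y0; have ln2_gt0 : 0 < ln 2 :> R by rewrite ln_gt0 // ltr1n.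
by rewrite /log2 ler_pM2r ?invr_gt0 // ler_ln.
Qed.

Lemma log2_load_pow2_objects (R : realType) (n : nat) : (0 < n)%N ->
  n%:R <= log2 ((load (pow2_objects n))%:R : R) <= (2 * n)%:R.
Proof.
move=> n0; have loadE := load_pow2_objects n.
have pow2_gt0 : (0 < 2 ^ n)%N by rewrite expn_gt0.
have n_lt_pow2 : (n < 2 ^ n)%N by rewrite ltn_expl.
have load_geq : (2 ^ n <= load (pow2_objects n))%N by nia.
have load_leq : (load (pow2_objects n) <= 2 ^ (2 * n))%N.
  by rewrite mul2n -addnn expnD; nia.
have load_gt0 : (0 < load (pow2_objects n))%N by exact: leq_trans load_geq.
rewrite -[n%:R]log2_exp2 -[(2 * n)%:R]log2_exp2.
by rewrite !ler_log2 ?posrE ?ltr0n ?expn_gt0 // !ler_nat load_geq.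
Qed.

Lemma pow2_load_div_log2 (R : realType) (n : nat) : (0 < n)%N ->
  let M : R := (load (pow2_objects n))%:R in
  2^-1 * M / log2 M <= (2 ^ n)%N%:R /\ (4 * 2 ^ n)%N%:R <= 8%:R * M / log2 M.
Proof.
move=> n0 M; have /andP[log_ge log_le] := log2_load_pow2_objects R n0.
have loadE := load_pow2_objects n.
have pow2_gt0 : (0 < 2 ^ n)%N by rewrite expn_gt0.
have log_gt0 : 0 < log2 M by apply: lt_le_trans log_ge; rewrite ltr0n.
rewrite ler_pdivrMr // ler_pdivlMr //; split.
  apply: (@le_trans _ _ ((2 ^ n)%N%:R * n%:R)); last by rewrite ler_wpM2l.
  by rewrite mulrC ler_pdivrMr // -!natrM ler_nat; nia.
apply: (@le_trans _ _ ((4 * 2 ^ n)%N%:R * (2 * n)%N%:R)).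
  by rewrite ler_wpM2l.
by rewrite -!natrM ler_nat; nia.
Qed.

Theorem theorem5p1 (R : realType) :
  exists c c1 c2 c3 c4 : R,
    [/\ 0 < c, 0 < c1, 0 < c2, 0 < c3 & 0 < c4] /\
    forall M0 : nat, (0 < M0)%N ->
    exists M : nat,
      [/\ (2 <= M)%N, c1 * M0%:R <= M%:R & M%:R <= c2 * M0%:R] /\
      forall (d : measure_display) (T : measurableType d)
             (P : probability T R) (A : allocator M T),
      exists s : seq update,
        [/\ legal M s,
            (forall x : object, x \in inserted s ->
               c3 * M%:R / log2 M%:R <= (mu x)%:R /\
               (mu x)%:R <= c4 * M%:R / log2 M%:R) &
            exists (h : seq update) (u : update) (r : seq update),
              s = h ++ u :: r /\
              ((c * M%:R)%:E <= expected_cost P A h u)%E].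
Proof.
exists 9^-1, 1, 11%:R, 2^-1, 8%:R; split; first by split; rewrite ?invr_gt0.
move=> M0 /exists_load_pow2_objects[n [n_gt1 M0_le load_le]].
have loadE := load_pow2_objects n.
have pow2_gt0 : (0 < 2 ^ n)%N by rewrite expn_gt0.
exists (load (pow2_objects n)); split.
  by rewrite mul1r -natrM !ler_nat; split => //; nia.
move=> d T P A; have distinct := @distinct_subset_sums_pow2 n.
have [||a [b [aX bX ab [h [u [r [exchange_eq cost_geq]]]]]]] :=
  exists_costly_exchange distinct P A (s := 2 ^ n).
- by move=> x /mu_pow2_objects/andP[].
- by rewrite card_pow2_objects.
exists (fill (pow2_objects n) ++ exchange a b); split.
- exact: legal_exchange.
- move=> x /(mu_inserted_exchange aX bX (@mu_pow2_objects n))/andP[lo hi].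
  have [le_pow2 pow2_le] := pow2_load_div_log2 R (ltnW n_gt1).
  split; first by apply: le_trans le_pow2 _; rewrite ler_nat.
  by apply: le_trans _ pow2_le; rewrite ler_nat; lia.
- exists h, u, r; split => //; apply: le_trans cost_geq.
  rewrite lee_fin mulrC ler_pM2r ?invr_gt0 // ler_nat card_pow2_objects.
  by rewrite mulnC -loadE.
Qed.
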